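(* Let $C$ be a nonempty, convex, and weakly compact subset of a normed space $X$ endowed with the weak topology. Let $\Phi: C \rightrightarrows X$ be such that (i) $\Phi(x)$ is nonempty and convex for every $x \in C$; (ii) $\Phi(C)$ is relatively weakly compact; (iii) $\Phi$ is sequentially weakly lower semicontinuous at every $x \in C$; (iv) $\Phi$ is weakly closed. Let $f:X \times X \to \mathbb{R}$ be a bifunction such that (a) $f(x,x)=0$ for every $x\in \Phi(C)$; (b) for every $x \in \Phi(C)$, the set $\{ y \in \Phi(C) : f(x,y) <0 \}$ is convex; (c) $f(\cdot,y)$ is sequentially upper semicontinuous for all $y \in \Phi(C)$; (d) $f$ is of type $S_+$ on $\Phi(C)$; (e) $|f(x,y)-f(x,z)| \le h(x) \|y-z\|$ for all $x,y,z \in \Phi(C)$, where $h: X \to \mathbb{R}_+$ is bounded on bounded sets. If a sequence $\{x_n\}$ generated by Algorithm 1 is asymptotically regular, then it admits a weak limit point which is a projected solution of $QEP(f,\Phi)$.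
   Context: Spaces are real; $\to^s$ and $\to^w$ denote strong (norm) and weak convergence. $\Phi(C)=\bigcup_{x\in C}\Phi(x)$. $\Phi:C\rightrightarrows X$ is sequentially weakly lower semicontinuous at $x\in C$ if for every sequence $\{x_n\}\subseteq C$ with $x_n\to^w x$ and every $y\in\Phi(x)$ there exist a subsequence $\{x_{n_k}\}$ and $y_k\in\Phi(x_{n_k})$ with $y_k\to^s y$. $\Phi$ is weakly closed if its graph is a weakly closed subset of $C\times X$. $f(\cdot,y)$ is sequentially upper semicontinuous if $x_n\to^s \bar x$ implies $f(\bar x,y)\ge\limsup_{n\to\infty} f(x_n,y)$. $f$ is of type $S_+$ on a set $D$ if for every $\{x_n\}\subseteq D$ with $x_n\to^w x\in D$ and $\liminf_{n\to\infty} f(x_n,x)\ge 0$ one has $x_n\to^s x$. For a nonempty set $K\subseteq X$, the equilibrium problem $EP(f,K)$ is to find $\bar x\in K$ with $f(\bar x,y)\ge 0$ for all $y\in K$; its solution set is $\mathrm{Sol}(f,K)$. Put $S(x)=\mathrm{Sol}(f,\Phi(x))$ for $x\in C$. The metric projection is $P_C(x)=\{z\in C:\|x-z\|\le\|x-w\|\ \text{for all } w\in C\}$. A point $x_0\in C$ is a projected solution of the quasi equilibrium problem $QEP(f,\Phi)$ if there exists $z_0\in S(x_0)$ with $x_0\in P_C(z_0)$. Algorithm 1: for $i=0$ choose $x_0\in C$; given $x_i$, solve $EP(f,\Phi(x_i))$, choose a point $z_i\in S(x_i)$, and choose $x_{i+1}\in P_C(z_i)$; if $x_{i+1}=x_i$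 stop, otherwise increase $i$ by 1 and repeat. If the algorithm stops at step $i$, the generated sequence is understood to be continued constantly, $x_j=x_i$ for $j\ge i$. A sequence $\{x_n\}$ is asymptotically regular if $\lim_{n\to\infty}\|x_n-x_{n+1}\|=0$. A weak limit point of a sequence is the weak limit of one of its subsequences. *)

(* Defs.v *)
From HB Require Import structures.
From mathcomp Require Export all_boot all_order all_algebra.
From mathcomp Require Export all_classical all_reals all_analysis.
Export Order.TTheory GRing.Theory Num.Theory.
Export numFieldNormedType.Exports.

Set Implicit Arguments.
Unset Strict Implicit.
Unset Printing Implicit Defensive.

Local Open Scope classical_set_scope.
Local Open Scope ring_scope.

(* A set-valued map from C to X is a total function Phi : X -> set X; only
   its values at points of C are ever used. *)

Definition image_of {X Y : Type} (Phi : X -> set Y) (C : set X) : set Y :=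
  \bigcup_(x in C) Phi x.

Section WeakTopology.
Context {R : realType}.

Definition dual (X : normedModType R) : Type :=
  {l : {linear X -> R^o} | continuous l}.

(* An alias of X carrying the coarsest topology that makes every element of
   [dual X] continuous. *)
Definition weak (X : normedModType R) : Type := X.

HB.instance Definition _ (X : normedModType R) :=
  Topological.copy (weak X)
    (sup_topology (fun l : dual X =>
       Topological.class (initial_topology (sval l : X -> R^o)))).

Variable X : normedModType R.
Implicit Types (C A : set X) (Phi : X -> set X) (x : nat -> X).

Definition weak_cvg x (l : X) : Prop :=
  (x : nat -> weak X) n @[n --> \oo] --> (l : weak X).

Definition weakly_compact A : Prop := compact (A : set (weak X)).

Definition relatively_weakly_compact A : Prop :=
  compact (closure (A : set (weak X))).

(* The graph is closed in C x X, as a subspace of the product of two copies of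
   X with the weak topology. *)
Definition weakly_closed_map C Phi : Prop :=
  closed ([set p | C p.1 /\ Phi p.1 p.2]
          : set (subspace (C `*` setT : set (weak X * weak X)))).

Definition seq_weakly_lsc_at C Phi (a : X) : Prop :=
  forall x : nat -> X, (forall n, C (x n)) -> weak_cvg x a ->
  forall y : X, Phi a y ->
  exists (s : nat -> nat) (y_ : nat -> X),
    [/\ {homo s : m n / (m < n)%N},
        forall k, Phi (x (s k)) (y_ k)
      & y_ k @[k --> \oo] --> y].

Definition weak_limit_point x (l : X) : Prop :=
  exists2 s : nat -> nat, {homo s : m n / (m < n)%N} & weak_cvg (x \o s) l.

End WeakTopology.

Section Equilibrium.
Context {R : realType} {X : normedModType R}.
Implicit Types (C D K : set X) (Phi : X -> set X) (f : X -> X -> R).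

Definition seq_usc (g : X -> R) : Prop :=
  forall (x : nat -> X) (a : X), x n @[n --> \oo] --> a ->
    (limn_esup (fun n => (g (x n))%:E) <= (g a)%:E)%E.

Definition type_Splus f D : Prop :=
  forall (x : nat -> X) (a : X), (forall n, D (x n)) -> D a -> weak_cvg x a ->
    (0 <= limn_einf (fun n => (f (x n) a)%:E))%E ->
    x n @[n --> \oo] --> a.

Definition Sol f K : set X := [set a | K a /\ forall y, K y -> 0 <= f a y].

Definition metric_proj C (a : X) : set X :=
  [set z | C z /\ forall w, C w -> `|a - z| <= `|a - w|].

Definition projected_solution C f Phi (x0 : X) : Prop :=
  C x0 /\ exists2 z0, Sol f (Phi x0) z0 & metric_proj C z0 x0.

(* Find z in Sol(f, Phi(x_i)), then x_(i+1) in P_C(z); stop if x_(i+1) = x_i.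
   Step i is carried out provided no earlier step has stopped the algorithm;
   once the algorithm stops, the sequence is continued constantly. *)
Definition generated_by_algorithm C f Phi (x : nat -> X) : Prop :=
  [/\ C (x 0%N),
      forall i, (forall k, (k < i)%N -> x k.+1 <> x k) ->
        exists2 z, Sol f (Phi (x i)) z & metric_proj C z (x i.+1)
    & forall i, x i.+1 = x i -> forall j, (i <= j)%N -> x j = x i].

Definition asymptotically_regular (x : nat -> X) : Prop :=
  `|x n - x n.+1| @[n --> \oo] --> (0 : R).

End Equilibrium.

(* Main.v *)
Require Import Defs.
From HB Require Import structures.
From mathcomp Require Import all_boot all_order all_algebra.
From mathcomp Require Import all_classical all_reals all_analysis.
From mathcomp Require Import lra.
Import Order.TTheory GRing.Theory Num.Theory numFieldNormedType.Exports.

(** The algorithm produces [x_ n] in [C], [z n] solving the equilibrium problem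
    on [Phi (x_ n)], and [x_ n.+1] a projection of [z n].  Weak compactness of
    [C] and of the weak closure of [Phi (C)] gives a subsequence along which
    [x_] and [z] have weak limits [xb] and [zb] (Eberlein-Smulian,
    [weakly_compact_subseq]), and [zb] lies in [Phi xb] since the graph is
    weakly closed.  Three facts make [xb] a projected solution.

    A point [y] of [Phi xb] is, by lower semicontinuity, the strong limit of
    points [v k] of [Phi (x_ (s k))].  As [0 <= f (z (s k)) (v k)] and [f] is
    Lipschitz in its second variable with a constant [h (z (s k))] that stays
    bounded, the lower limit of [f (z (s k)) y] is nonnegative
    ([equilibrium_liminf]).  The boundedness comes from the uniform boundedness
    principle: a weakly convergent sequence is bounded ([weak_cvg_bounded]).

    With [y := zb], the [S_+] property turns the weak convergence of [z] into
    strong convergence.  Then, with an arbitrary [y] in [Phi xb], upper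
    semicontinuity gives [0 <= f zb y], so [zb] solves the limit problem.

    Asymptotic regularity makes the shifted iterates [x_ n.+1] converge weakly
    to the same [xb], and the inequalities [`|z n - x_ n.+1| <= `|z n - w|]
    defining the projections pass to the limit: the right-hand side converges
    because [z] converges strongly, the left-hand side is weakly lower
    semicontinuous ([norm_weak_lsc]).

    The functional analysis rests on the Hahn-Banach theorem
    ([hahn_banach_at]), obtained from minimal sublinear functionals. *)

Set Implicit Arguments.
Unset Strict Implicit.
Unset Printing Implicit Defensive.
Local Open Scope classical_set_scope.
Local Open Scope ring_scope.

(** * The Hahn-Banach theorem *)

Section HahnBanach.
Context {R : realType} {V : lmodType R}.
Implicit Types (p q : V -> R) (v x y : V) (t : R).

Definition sublinear p : Prop :=
  (forall x y, p (x + y) <= p x + p y) /\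
  (forall t x, 0 <= t -> p (t *: x) <= t * p x).

Lemma sublinear0 p : sublinear p -> p 0 = 0.
Proof.
move=> [pD pZ]; apply/eqP; rewrite eq_le.
have := pZ 0 0 (lexx 0); rewrite scale0r mul0r => -> /=.
by have := pD 0 0; rewrite addr0 -[X in X <= _]add0r lerD2r.
Qed.

Lemma sublinearZ p t x : sublinear p -> 0 <= t -> p (t *: x) = t * p x.
Proof.
move=> sp; rewrite le_eqVlt => /predU1P[<-|t0].
  by rewrite scale0r mul0r sublinear0.
apply/eqP; rewrite eq_le (sp.2 _ _ (ltW t0)) /= -ler_pdivlMl//.
have := sp.2 t^-1 (t *: x).
by rewrite scalerA mulVf ?gt_eqF// scale1r; apply; rewrite invr_ge0 ltW.
Qed.

Lemma sublinear_geN p x : sublinear p -> - p (- x) <= p x.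
Proof.
by move=> sp; have := sp.1 x (- x); rewrite subrr sublinear0//; lra.
Qed.

(** The largest sublinear functional below [q] whose value at [- v] is
    [- q v]: it lowers [q] just enough to make it linear along [v].  A minimal
    sublinear functional cannot be lowered, hence is linear in every
    direction. *)
Definition flatten_along q v x : R :=
  inf [set q (x + t *: v) - t * q v | t in [set t | 0 <= t]].

Lemma flatten_along_le q v x t : sublinear q -> 0 <= t ->
  flatten_along q v x <= q (x + t *: v) - t * q v.
Proof.
move=> sq t0; apply: ge_inf; last by exists t.
exists (- q (- x)) => _ [s /= s0 <-].
have := sq.1 (x + s *: v) (- x); rewrite addrAC subrr add0r sublinearZ//; lra.
Qed.

Lemma le_flatten_along q v x r :
  (forall t, 0 <= t -> r <= q (x + t *: v) - t * q v) ->
  r <= flatten_along q v x.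
Proof.
move=> rq; apply: lb_le_inf.
  by exists (q (x + 0 *: v) - 0 * q v), 0 => /=.
by move=> _ [t /= t0 <-]; exact: rq.
Qed.

Lemma flatten_along_sublinear q v :
  sublinear q -> sublinear (flatten_along q v).
Proof.
move=> sq; split=> [x y|t x t0].
  rewrite -lerBlDr; apply: le_flatten_along => s s0.
  rewrite lerBlDr -lerBlDl; apply: le_flatten_along => t t0.
  rewrite lerBlDr (le_trans (flatten_along_le _ _ sq (addr_ge0 s0 t0)))//.
  have := sq.1 (x + s *: v) (y + t *: v).
  rewrite scalerDl addrACA; lra.
move: t0; rewrite le_eqVlt => /predU1P[<-|t0].
  rewrite scale0r mul0r (le_trans (flatten_along_le _ _ sq (lexx 0)))//.
  by rewrite scale0r addr0 sublinear0// mul0r subr0.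
rewrite -ler_pdivrMl//; apply: le_flatten_along => s s0; rewrite ler_pdivrMl//.
rewrite (le_trans (flatten_along_le _ _ sq (mulr_ge0 (ltW t0) s0)))//.
by rewrite -scalerA -scalerDr (sublinearZ _ sq (ltW t0)); lra.
Qed.

Lemma flatten_alongW q v x : sublinear q -> flatten_along q v x <= q x.
Proof.
move=> /flatten_along_le-/(_ v x 0 (lexx 0)).
by rewrite scale0r addr0 mul0r subr0.
Qed.

Lemma flatten_along1 q v x : sublinear q ->
  flatten_along q v x <= q (x + v) - q v.
Proof. by move=> /flatten_along_le-/(_ v x 1 ler01); rewrite scale1r mul1r. Qed.

(** Zorn's lemma: the bound [- p (- x) <= q x] keeps the pointwise infimum of a
    chain finite, and subadditivity survives since any two members of a chain
    have one of them below both. *)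
Lemma exists_minimal_sublinear p : sublinear p ->
  exists q, [/\ sublinear q, forall x, q x <= p x &
    forall r, sublinear r -> (forall x, r x <= q x) -> forall x, q x <= r x].
Proof.
move=> sp.
pose T := {q | sublinear q /\ forall x, q x <= p x}.
have sub_le q : sublinear q -> (forall x, q x <= p x) ->
    forall x, - p (- x) <= q x.
  by move=> sq qp x; rewrite (le_trans _ (sublinear_geN x sq))// lerN2.
pose top : T := exist _ p (conj sp (fun x => lexx (p x))).
pose ge (q r : T) := `[< forall x, sval r x <= sval q x >].
have [||A totA|[q [sq qp]] qmin] := @ZL_preorder T top ge.
- by move=> q; apply/asboolP => x.
- move=> r s t /asboolP rs /asboolP st; apply/asboolP => x.
  exact: le_trans (st x) (rs x).
(* adding [top] makes the empty chain harmless *)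
- pose B := A `|` [set top].
  have ltop (q : T) : ge top q by apply/asboolP; case: (svalP q).
  have totB (q r : T) : B q -> B r ->
      exists2 s, B s & forall x, sval s x <= sval q x /\ sval s x <= sval r x.
    have inB (q' r' : T) : B q' -> B r' -> ge q' r' ->
      exists2 s, B s & forall x, sval s x <= sval q' x /\ sval s x <= sval r' x.
      by move=> Bq Br /asboolP qr; exists r'.
    have sym (q' r' : T) : (exists2 s, B s &
        forall x, sval s x <= sval q' x /\ sval s x <= sval r' x) ->
      exists2 s, B s & forall x, sval s x <= sval r' x /\ sval s x <= sval q' x.
      by move=> [s Bs h]; exists s => // x; have [] := h x.
    move=> [Aq|->] [Ar|->].
    + case: (totA _ _ Aq Ar) => h; first by apply: inB => //; left.
      by apply: sym; apply: inB => //; left.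
    + by apply: sym; apply: inB => //; [right|left].
    + by apply: inB => //; [right|left].
    + by apply: inB => //; right.
  pose l x := inf [set sval (q : T) x | q in B].
  have lle (q : T) x : B q -> l x <= sval q x.
    move=> Bq; apply: ge_inf; last by exists q.
    by exists (- p (- x)) => _ [r _ <-]; apply: sub_le; case: (svalP r).
  have lel (r : R) x : (forall q : T, B q -> r <= sval q x) -> r <= l x.
    move=> rB; apply: lb_le_inf; first by exists (p x), top => //; right.
    by move=> _ [q Bq <-]; exact: rB.
  have sl : sublinear l.
    split=> [x y|t x].
      rewrite -lerBlDr; apply/lel => q Bq; rewrite lerBlDr -lerBlDl.
      apply/lel => r Br; rewrite lerBlDr.
      have [s Bs sqr] := totB _ _ Bq Br.
      apply: (le_trans (lle _ _ Bs)); have [sD _] := (svalP s).1.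
      apply: (le_trans (sD _ _)); rewrite addrC.
      by apply: lerD; [have [] := sqr y|have [] := sqr x].
    rewrite le_eqVlt => /predU1P[<-|t0].
      rewrite scale0r mul0r (le_trans (lle top _ _))//; first by right.
      by rewrite /= sublinear0.
    rewrite -ler_pdivrMl//; apply/lel => q Bq; rewrite ler_pdivrMl//.
    rewrite (le_trans (lle _ _ Bq))//.
    by have [_ ->//] := (svalP q).1; rewrite ltW.
  have lp x : l x <= p x by apply: (lle top); right.
  exists (exist _ l (conj sl lp)) => q Aq.
  by apply/asboolP => x; apply: (lle); left.
- exists q; split => // r sr rq x.
  have rp y : r y <= p y by apply: le_trans (qp y).
  have := qmin (exist _ r (conj sr rp)); rewrite /ge.
  by move=> h; have /asboolP := h (asboolT rq); exact.
Qed.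

(** Hahn-Banach at a point: start from the functional [p] flattened along [v],
    which takes the value [- p v] at [- v], and pass to a minimal sublinear
    functional below it; minimality against its own flattenings makes it
    additive. *)
Theorem hahn_banach_at p v : sublinear p ->
  exists l : V -> R, [/\ forall x y, l (x + y) = l x + l y,
    forall t x, l (t *: x) = t * l x, forall x, l x <= p x & l v = p v].
Proof.
move=> sp.
have [l [sl lp lmin]] :=
  exists_minimal_sublinear (flatten_along_sublinear v sp).
have lD x y : l (x + y) = l x + l y.
  apply/eqP; rewrite eq_le sl.1 /= -lerBrDr.
  apply: le_trans (flatten_along1 y x sl).
  apply: lmin; first exact: flatten_along_sublinear.
  by move=> z; exact: flatten_alongW.
have lN x : l (- x) = - l x.
  by apply/eqP; rewrite -addr_eq0 -lD addNr sublinear0.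
have lep x : l x <= p x by apply: le_trans (lp x) (flatten_alongW _ _ sp).
exists l; split => //.
- move=> t x; have [t0|t0] := leP 0 t; first exact: sublinearZ.
  by rewrite -[t]opprK scaleNr lN sublinearZ ?oppr_ge0 ?(ltW t0)// !mulNr opprK.
- apply/eqP; rewrite eq_le lep /= -lerN2 -lN.
  apply: (le_trans (lp _)); apply: (le_trans (flatten_along1 _ _ sp)).
  by rewrite addNr sublinear0// sub0r.
Qed.

End HahnBanach.

(** * The dual space and weak convergence *)

Section Duals.
Context {R : realType} {X : normedModType R}.
Implicit Types (x v : X) (phi : dual X).

Lemma dual_of_bounded (l : X -> R) (M : R) :
  (forall x y, l (x + y) = l x + l y) -> (forall t x, l (t *: x) = t * l x) ->
  (forall x, `|l x| <= M * `|x|) ->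
  exists phi, forall x, sval phi x = l x.
Proof.
move=> lD lZ lM.
have lin : linear (l : X -> R^o) by move=> t x y; rewrite lD lZ.
pose L : {linear X -> R^o} :=
  HB.pack (l : X -> R^o) (GRing.isLinear.Build _ _ _ _ _ lin).
have cL : continuous L.
  apply/bounded_linear_continuous/linear_boundedP.
  exists M; split=> [|r Mr x]; first exact: num_real.
  by apply: (le_trans (lM x)); apply: ler_wpM2r => //; exact: ltW.
by exists (exist _ L cL).
Qed.

Lemma dualD phi x v : sval phi (x + v) = sval phi x + sval phi v.
Proof. by rewrite linearD. Qed.

Lemma dualB phi x v : sval phi (x - v) = sval phi x - sval phi v.
Proof. by rewrite linearB. Qed.

Lemma dualZ phi (t : R) v : sval phi (t *: v) = t * sval phi v.
Proof. by rewrite linearZ. Qed.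

(** Domination by the norm makes the Hahn-Banach functional continuous. *)
Lemma sublinear_dual (p : X -> R) v : sublinear p -> (forall x, p x <= `|x|) ->
  exists phi, sval phi v = p v /\ forall x, sval phi x <= p x.
Proof.
move=> sp pn; have [l [lD lZ lp lv]] := hahn_banach_at v sp.
have lN x : l (- x) = - l x by rewrite -scaleN1r lZ mulN1r.
have [|phi phil] := @dual_of_bounded l 1 lD lZ.
  move=> x; rewrite mul1r ler_norml (le_trans (lp _) (pn _)) andbT.
  by rewrite lerNl -lN (le_trans (lp _))// (le_trans (pn _))// normrN.
by exists phi; rewrite phil; split=> // x; rewrite phil.
Qed.

Lemma norming_dual v :
  exists phi, sval phi v = `|v| /\ forall x, `|sval phi x| <= `|x|.
Proof.
have sn : sublinear (fun x : X => `|x| : R).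
  split=> [x y|t x t0]; first exact: ler_normD.
  by rewrite normrZ ger0_norm.
have [//|phi [phiv phin]] := @sublinear_dual _ v sn.
exists phi; split=> // x; rewrite ler_norml phin andbT lerNl.
by rewrite -linearN (le_trans (phin _))// normrN.
Qed.

Lemma dual_weak_continuous phi : continuous (sval phi : weak X -> R^o).
Proof.
move=> x; have /cvg_sup/(_ phi) : nbhs (x : weak X) --> (x : weak X) by [].
move=> xphi; apply: cvg_trans (@initial_continuous _ _ (sval phi) x).
by apply: cvg_fmap2.
Qed.

(** The weak topology is initial for the dual, so weak convergence is tested
    one functional at a time. *)
Lemma weak_cvgP (u : nat -> X) x :
  weak_cvg u x <-> forall phi, sval phi (u n) @[n --> \oo] --> sval phi x.
Proof.
split=> [ux phi|ux].
  by apply: (cvg_comp _ _ ux); exact: dual_weak_continuous.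
apply/cvg_sup => phi A; rewrite nbhsE => -[B [[C oC <-]] /= Cx BA].
have := ux phi C (@open_nbhs_nbhs R^o _ _ (conj oC Cx)).
by apply: (@filterS _ \oo) => n Cn; exact: BA.
Qed.

Lemma strong_weak_cvg (u : nat -> X) x : u n @[n --> \oo] --> x -> weak_cvg u x.
Proof.
move=> ux; apply/weak_cvgP => phi.
by apply: (cvg_comp _ _ ux); exact: (svalP phi).
Qed.

End Duals.

(** * The uniform boundedness principle *)

Section UniformBoundedness.
Context {R : realType} {X : normedModType R}.

(** Partial sums of the series of the functionals [3^-k phi k] with signs.  One
    of [`|a + b|], [`|a - b|] is always at least [`|b|], so the signs can be
    chosen to prevent any cancellation at the points [z k]. *)
Fixpoint hump_sum (phi : nat -> dual X) (z : nat -> X) (k : nat) : X -> R :=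
  if k isn't k'.+1 then fun=> 0 else
  let s := hump_sum phi z k' in
  let b := fun x => 3^-1 ^+ k' * sval (phi k') x in
  if `|b (z k')| <= `|s (z k') + b (z k')|
  then fun x => s x + b x else fun x => s x - b x.

Variables (phi : nat -> dual X) (z : nat -> X).
Hypothesis phi_le : forall k x, `|sval (phi k) x| <= `|x|.
Local Notation s := (hump_sum phi z).

Lemma hump_sum_ge k : 3^-1 ^+ k * `|sval (phi k) (z k)| <= `|s k.+1 (z k)|.
Proof.
have t0 : 0 <= 3^-1 ^+ k :> R by rewrite exprn_ge0// invr_ge0.
rewrite -{1}(ger0_norm t0) -normrM /=; case: ifPn => [//|].
rewrite -ltNge => h; set a := s k (z k) in h *; set b := _ * _ in h *.
have := ler_normB (a + b) (a - b).
have -> : a + b - (a - b) = b *+ 2 by lra.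
by rewrite normrMn; lra.
Qed.

Lemma hump_sumD k x y : s k (x + y) = s k x + s k y.
Proof.
elim: k => [|k IH] /=; first by rewrite addr0.
by case: ifP => _; rewrite IH dualD mulrDr; lra.
Qed.

Lemma hump_sumZ k t x : s k (t *: x) = t * s k x.
Proof.
elim: k => [|k IH] /=; first by rewrite mulr0.
by case: ifP => _; rewrite IH dualZ; lra.
Qed.

Lemma hump_sum_dist k x : `|s k.+1 x - s k x| <= 3^-1 ^+ k * `|x|.
Proof.
have t0 : 0 <= 3^-1 ^+ k :> R by rewrite exprn_ge0// invr_ge0.
rewrite /=; case: ifP => _; rewrite addrAC subrr add0r ?normrN normrM;
  by rewrite (ger0_norm t0) ler_wpM2l.
Qed.

(** The weights [3^-j] for [k <= j < k + m] have sum
    [3 / 2 * (3^-k - 3^-(k + m))]. *)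
Lemma hump_sum_tail k m x :
  `|s (k + m)%N x - s k x| <= 3 / 2 * (3^-1 ^+ k - 3^-1 ^+ (k + m)) * `|x|.
Proof.
elim: m => [|m IH]; first by rewrite addn0 !subrr normr0 mulr0 mul0r.
rewrite addnS; have := hump_sum_dist (k + m) x.
have := ler_normD (s (k + m).+1 x - s (k + m)%N x) (s (k + m)%N x - s k x).
by rewrite addrA subrK exprS; move: IH; set a := `|x|; nra.
Qed.

Lemma hump_sum_cvg x : cvgn (s ^~ x).
Proof.
(* subtracting the tail bound [g] makes the partial sums nondecreasing *)
pose g k : R := 3 / 2 * `|x| * 3^-1 ^+ k.
have g0 : g k @[k --> \oo] --> (0 : R).
  by apply: cvg_geometric; rewrite ger0_norm ?invr_ge0// invf_lt1//; lra.
have inc : {homo (fun k => s k x - g k) : n m / (n <= m)%N >-> n <= m}.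
  move=> n m nm; have := hump_sum_tail n (m - n) x.
  by rewrite subnKC// ler_norml => /andP[+ _]; rewrite /g; nra.
have gs : cvgn (fun k => s k x - g k).
  apply: nondecreasing_is_cvgn => //; exists (3 / 2 * `|x|) => _ [k _ <-].
  have := hump_sum_tail 0 k x.
  rewrite add0n /= subr0 expr0 ler_norml => /andP[_].
  rewrite /g; have : 0 <= 3^-1 ^+ k :> R by rewrite exprn_ge0// invr_ge0.
  by have : 0 <= `|x| by []; nra.
have -> : (fun k => s k x) = (fun k => s k x - g k) \+ g.
  by apply/funext => k /=; rewrite subrK.
by apply: is_cvgD => //; apply/cvg_ex; exists 0.
Qed.

End UniformBoundedness.

(** Uniform boundedness, by a gliding hump.  If [u] were unbounded, choose
    points [z k] of it with [2 k 3^k < `|z k|] and functionals [phi k] of norm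
    at most one attaining the norm at [z k].  At [z k] the partial sum with
    index [k.+1] is at least [3^-k `|z k|], and the remaining tail takes away at
    most half of that; so the limit functional exceeds [k] at [z k]. *)
Lemma weakly_bounded_bounded {R : realType} {X : normedModType R}
    (u : nat -> X) :
  (forall phi : dual X, exists M : R, forall n, `|sval phi (u n)| <= M) ->
  exists M : R, forall n, `|u n| <= M.
Proof.
move=> ub; apply: contrapT => unb.
have big (k : nat) : exists n, k%:R * 2 * 3 ^+ k < `|u n|.
  apply: contrapT => small; apply: unb; exists (k%:R * 2 * 3 ^+ k) => n.
  by rewrite leNgt; apply/negP => h; apply: small; exists n.
have [v vP] := choice big; pose z k := u (v k).
have [phi phiP] := choice (fun k => norming_dual (z k)).
have phi_le k x : `|sval (phi k) x| <= `|x| by have [_] := phiP k; exact.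
pose s := hump_sum phi z.
pose l x : R := limn (s ^~ x).
have sl x : s k x @[k --> \oo] --> l x by exact: hump_sum_cvg.
have lD x y : l (x + y) = l x + l y.
  apply: cvg_lim => //; under eq_cvg do rewrite /s hump_sumD.
  exact: cvgD.
have lZ t x : l (t *: x) = t * l x.
  apply: cvg_lim => //; under eq_cvg do rewrite /s hump_sumZ.
  exact: cvgMl_tmp.
have tail k x : `|l x - s k x| <= 3 / 2 * 3^-1 ^+ k * `|x|.
  have lsx : `|s (m + k)%N x - s k x| @[m --> \oo] --> `|l x - s k x|.
    apply: cvg_norm; apply: cvgB; last exact: cvg_cst.
    by rewrite (cvg_shiftn k (s ^~ x)).
  apply: (closed_cvg (fun r => r <= _) (@closed_le _ _) _ _ lsx).
  apply: nearW => m /=; rewrite addnC.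
  apply: (le_trans (hump_sum_tail z phi_le k m x)).
  have : 0 <= 3^-1 ^+ (k + m) :> R by rewrite exprn_ge0// invr_ge0.
  by have : 0 <= `|x| by []; nra.
have [|L Ll] := @dual_of_bounded _ _ l (3 / 2) lD lZ.
  by move=> x; have := tail 0%N x; rewrite /s /= subr0 expr0 mulr1.
have [M LM] := ub L.
(* the hump of index [k] already exceeds the bound [M] *)
pose k := (Num.truncn `|M|).+1.
have Mk : M < k%:R by rewrite (le_lt_trans (ler_norm M))// truncnS_gt.
have := LM (v k); rewrite Ll -/(z k).
have := hump_sum_ge phi z k; have := tail k.+1 (z k).
have := ler_normB (l (z k)) (l (z k) - s k.+1 (z k)).
rewrite subKr (phiP k).1 normr_id -/s exprS.
have t0 : 0 < 3^-1 ^+ k :> R by rewrite exprn_gt0// invr_gt0.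
have : 3^-1 ^+ k * (k%:R * 2 * 3 ^+ k) <= 3^-1 ^+ k * `|z k|.
  by rewrite ler_pM2l// ltW// vP.
have -> : 3^-1 ^+ k * (k%:R * 2 * 3 ^+ k) = k%:R * 2 :> R.
  by rewrite mulrC -[LHS]mulrA -exprMn divff ?expr1n ?mulr1//.
by move: (k%:R) Mk t0 => K; set t := 3^-1 ^+ k; set a := `|z k|; nra.
Qed.

(** * Weak sequential compactness *)

Section CountableCombinations.
Context {R : realType} {X : normedModType R}.
Variable u : nat -> X.
Implicit Types (s : seq (rat * nat)) (x y : X).

(** Indexing the rational linear combinations of [u] by lists makes them a
    countable family closed under sums (concatenation) and rational
    multiples. *)
Definition rat_comb s : X := \sum_(a <- s) (ratr a.1 : R) *: u a.2.

Definition dist_combs x : R := inf [set `|x - rat_comb s| | s in setT].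

Lemma rat_comb_cat s1 s2 : rat_comb (s1 ++ s2) = rat_comb s1 + rat_comb s2.
Proof. by rewrite /rat_comb big_cat. Qed.

Lemma rat_combZ (q : rat) s :
  rat_comb [seq (q * a.1, a.2) | a <- s] = (ratr q : R) *: rat_comb s.
Proof.
rewrite /rat_comb big_map scaler_sumr.
by apply: eq_bigr => a _; rewrite rmorphM scalerA.
Qed.

Lemma rat_comb1 n : rat_comb [:: (1, n)] = u n.
Proof. by rewrite /rat_comb big_seq1 rmorph1 scale1r. Qed.

Lemma dist_combs_le s x : dist_combs x <= `|x - rat_comb s|.
Proof. by apply: ge_inf; [exists 0 => _ [r _ <-] | exists s]. Qed.

Lemma le_dist_combs (r : R) x :
  (forall s, r <= `|x - rat_comb s|) -> r <= dist_combs x.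
Proof.
move=> rx; apply: lb_le_inf; first by exists `|x - rat_comb [::]|, [::].
by move=> _ [s _ <-]; exact: rx.
Qed.

Lemma dist_combs_lt x (e : R) : dist_combs x < e ->
  exists s, `|x - rat_comb s| < e.
Proof.
move=> /inf_lt[|_ [s _ <-]]; first by exists `|x - rat_comb [::]|, [::].
by exists s.
Qed.

Lemma dist_combs_norm x : dist_combs x <= `|x|.
Proof. by have := dist_combs_le [::] x; rewrite /rat_comb big_nil subr0. Qed.

Lemma dist_combsD x y : dist_combs (x + y) <= dist_combs x + dist_combs y.
Proof.
rewrite -lerBlDr; apply: le_dist_combs => s1; rewrite lerBlDr -lerBlDl.
apply: le_dist_combs => s2; rewrite lerBlDl.
apply: (le_trans (dist_combs_le (s1 ++ s2) _)).
by rewrite rat_comb_cat opprD addrACA ler_normD.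
Qed.

(** Real multiples of a combination are limits of its rational multiples. *)
Lemma dist_combs_scaled (t : R) s : dist_combs (t *: rat_comb s) <= 0.
Proof.
apply/ler_addgt0Pl => e e0; rewrite addr0.
have N0 : 0 < `|rat_comb s| + 1 by rewrite ltr_wpDl.
have tt : t < t + e / (`|rat_comb s| + 1) by rewrite ltrDl divr_gt0.
have [q] := rat_in_itvoo tt; rewrite in_itv /= => /andP[tq qt].
apply: (le_trans (dist_combs_le [seq (q * a.1, a.2) | a <- s] _)).
rewrite rat_combZ -scalerBl normrZ ler0_norm ?subr_le0 ?(ltW tq)// opprB.
apply: (@le_trans _ _ (e / (`|rat_comb s| + 1) * `|rat_comb s|)).
  by rewrite ler_wpM2r// lerBlDl ltW.
by rewrite -mulrA ler_piMr ?(ltW e0)// mulrC ler_pdivrMr// mul1r lerDl.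
Qed.

Lemma dist_combsZ (t : R) x : dist_combs (t *: x) <= `|t| * dist_combs x.
Proof.
have [->|t0] := eqVneq t 0.
  by rewrite scale0r normr0 mul0r (le_trans (dist_combs_norm _))// normr0.
rewrite -ler_pdivrMl ?normr_gt0//; apply: le_dist_combs => s.
rewrite ler_pdivrMl ?normr_gt0// -normrZ scalerBr.
rewrite -[t *: x](subrK (t *: rat_comb s)).
apply: (le_trans (dist_combsD _ _)).
rewrite addrK -[leRHS]addr0; apply: lerD.
  exact: dist_combs_norm.
exact: dist_combs_scaled.
Qed.

Lemma dist_combs_sublinear : sublinear dist_combs.
Proof.
split=> [|t x t0]; first exact: dist_combsD.
by rewrite -{2}(ger0_norm t0) dist_combsZ.
Qed.

(** Otherwise the functional dominated by the distance to the span and equal to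
    it at [y] would vanish on [u] and be positive near [y]. *)
Lemma weak_closure_dist_combs y :
  closure (range u : set (weak X)) y -> dist_combs y <= 0.
Proof.
move=> cly; rewrite leNgt; apply/negP => y0.
have [phi [phiy phile]] :=
  sublinear_dual y dist_combs_sublinear dist_combs_norm.
have phiu n : sval phi (u n) <= 0.
  apply: (le_trans (phile _)).
  by have := dist_combs_scaled 1 [:: (1, n)]; rewrite scale1r rat_comb1.
have [|_ [[n _ <-] /=]] := cly [set x | 0 < sval phi x]; last first.
  by rewrite ltNge phiu.
rewrite -phiy in y0.
exact: (cvgr_gt (sval phi y) (@dual_weak_continuous _ _ phi y)).
Qed.

(** Near [x] there is a combination [c]; the functional norming [c] vanishes at
    [x], so it is small at [c], and hence [c] and [x] are small. *)
Lemma dist_combs_separated (psi : seq (rat * nat) -> dual X) x :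
  (forall s, sval (psi s) (rat_comb s) = `|rat_comb s|) ->
  (forall s y, `|sval (psi s) y| <= `|y|) ->
  dist_combs x <= 0 -> (forall s, sval (psi s) x = 0) -> x = 0.
Proof.
move=> psis psile x0 psix; apply/eqP; rewrite -normr_le0.
apply/ler_addgt0Pl => e e0; rewrite addr0.
have [|s xs] := @dist_combs_lt x (e / 2).
  by rewrite (le_lt_trans x0)// divr_gt0.
have := psile s (x - rat_comb s); rewrite dualB psix sub0r normrN psis normr_id.
have := ler_normD (x - rat_comb s) (rat_comb s); rewrite subrK; lra.
Qed.

End CountableCombinations.

(** Eberlein-Smulian.  Let [y] be a weak cluster point of [u], and [psi] the
    countable family of functionals norming the rational combinations of [u].
    Since [psi] is countable, there is a subsequence along which every [psi t]
    converges to its value at [y].  Any cluster point of this subsequence agrees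
    with [y] on [psi] and lies in the closed span of [u], hence equals [y]; in a
    compact set, a sequence with a single cluster point converges to it. *)
Theorem weakly_compact_subseq {R : realType} {X : normedModType R} (K : set X)
    (u : nat -> X) :
  weakly_compact K -> (forall n, K (u n)) ->
  exists s : nat -> nat, {homo s : m n / (m < n)%N} /\
    exists2 y, K y & weak_cvg (u \o s) y.
Proof.
move=> cK Ku.
have [|y [Ky cly]] := cK ((u : nat -> weak X) @ \oo) _.
  by exists 0%N => // n _; exact: Ku.
have [psi psiP] := choice (fun s => norming_dual (rat_comb u s)).
have psis s : sval (psi s) (rat_comb u s) = `|rat_comb u s| := (psiP s).1.
have psile s : forall x, `|sval (psi s) x| <= `|x| := (psiP s).2.
(* agreement with [y] up to [j.+1^-1] on the [psi s] with [pickle s <= j] *)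
pose close (j : nat) (x : X) := forall k : 'I_j.+1,
  oapp (fun s => `|sval (psi s) x - sval (psi s) y| < j.+1%:R^-1) true
    (unpickle k).
have nclose j : nbhs (y : weak X) (close j).
  apply: (@filter_forall _ _ _ (nbhs (y : weak X))) => k.
  case: unpickle => [s|] /=; last exact: nearW.
  have /cvgrPdist_lt/(_ j.+1%:R^-1) := @dual_weak_continuous _ _ (psi s) y.
  rewrite invr_gt0 ltr0Sn => /(_ isT); apply: filterS => x.
  by rewrite distrC.
have ex (jN : nat * nat) : exists n, (jN.2 < n)%N /\ close jN.1 (u n).
  have [|_ [[n /= Nn <-] cn]] :=
    cly [set u n | n in [set n | (jN.2 < n)%N]] _ _ (nclose jN.1).
    by exists jN.2.+1 => // n /= Nn; exists n.
  by exists n.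
have [g gP] := choice ex.
pose s := fix s (j : nat) := if j is j'.+1 then g (j, s j') else g (0, 0)%N.
have sclose j : close j (u (s j)).
  by case: j => [|j]; [exact: (gP (0, 0)%N).2|exact: (gP (j.+1, s j)).2].
have shomo : {homo s : m n / (m < n)%N}.
  apply: homo_ltn => [m n p|j]; first exact: ltn_trans.
  exact: (gP (j.+1, s j)).1.
have psi_cvg t : sval (psi t) (u (s j)) @[j --> \oo] --> sval (psi t) y.
  apply/cvgrPdist_lt => e e0; near=> j.
  have tj : (pickle t < j.+1)%N by rewrite ltnS; near: j; exact: nbhs_infty_ge.
  have := sclose j (Ordinal tj); rewrite pickleK /= distrC.
  move=> /lt_le_trans; apply.
  by apply: ltW; near: j; exact: (near_infty_natSinv_lt (PosNum e0)).
exists s; split=> //; exists y => // U Uy; apply: contrapT => FU.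
(* [G] is the trace on the complement of [U], a neighbourhood of [y] that the
   subsequence leaves infinitely often *)
pose F : set_system (weak X) := (u \o s) @ \oo.
pose G := within (~` U) F.
have PG : ProperFilter G.
  apply: Build_ProperFilter_ex.
  move=> P FP; apply: contrapT => nP; apply: FU.
  apply: (@filterS _ F _ (fun x => ~ U x -> P x) U _ FP) => x Px.
  by apply: contrapT => Ux; apply: nP; exists x; exact: Px.
have FG : G --> F by exact: cvg_within.
have [|y' [Ky' cly']] := cK G PG.
  by exists 0%N => // j _ _; exact: Ku.
suff yy' : y' = y.
  have GU : G (~` U) by exact: withinT.
  have yU : nbhs (y' : weak X) U by rewrite yy'.
  by have [x [nUx Ux]] := cly' _ _ GU yU; exact: nUx.
apply/eqP; rewrite -subr_eq0; apply/eqP.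
apply: (@dist_combs_separated _ _ u psi) => // [|t].
  have cl (x : weak X) (H : set_system (weak X)) :
      cluster H x -> H (range u) -> dist_combs u x <= 0.
    by rewrite clusterE => clx Hu; apply: weak_closure_dist_combs; exact: clx.
  apply: (le_trans (dist_combsD _ _ _)).
  rewrite -[leRHS]addr0; apply: lerD.
    by apply: (cl _ _ cly'); exists 0%N => // j _ _; exists (s j).
  rewrite -scaleN1r (le_trans (dist_combsZ _ _ _))// normrN1 mul1r.
  by apply: (cl _ _ cly); exists 0%N => // n _; exists n.
rewrite dualB; apply/eqP; rewrite -normr_le0; apply/ler_addgt0Pl => e e0.
rewrite addr0; have e20 : 0 < e / 2 by rewrite divr_gt0.
have G1 : G [set x | `|sval (psi t) y - sval (psi t) x| < e / 2].
  by apply: FG; move/cvgrPdist_lt: (psi_cvg t); exact.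
have /cvgrPdist_lt/(_ _ e20) := @dual_weak_continuous _ _ (psi t) y'.
move=> /(cly' _ _ G1)[x [/=]].
have := ler_distD (sval (psi t) x) (sval (psi t) y') (sval (psi t) y).
rewrite (distrC (sval (psi t) x) (sval (psi t) y)); lra.
Unshelve. all: by end_near. Qed.

(** * Sequences and weak limits *)

Lemma subsequence_cvg (s : nat -> nat) :
  {homo s : m n / (m < n)%N} -> s @ \oo --> \oo.
Proof.
move=> sh A [N _ NA]; exists N => // n /= Nn; apply: NA => /=.
apply: (leq_trans Nn); elim: n {Nn} => // n IH.
by apply: (leq_ltn_trans IH); exact: sh.
Qed.

Lemma limn_einf_ge0 {R : realType} (u g : nat -> R) :
  g n @[n --> \oo] --> (0 : R) -> (forall n, g n <= u n) ->
  (0 <= limn_einf (fun n => (u n)%:E))%E.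
Proof.
move=> g0 gu; apply/lee_addgt0Pr => e e0.
have ge : \forall n \near \oo, - e < g n.
  by apply: (cvgr_gt _ g0); rewrite oppr_lt0.
rewrite -leeBlDr // sub0e.
rewrite -[limn_einf _]/(limf_einf _ \oo) limf_einfE.
apply: (@le_trans _ _ (ereal_inf ((fun n => (u n)%:E) @` [set n | - e < g n]))).
  apply: le_ereal_inf_tmp => _ [n /= en <-]; rewrite lee_fin.
  exact: le_trans (ltW en) (gu n).
by apply: ereal_sup_ubound; exists [set n | - e < g n].
Qed.

Section WeakSequences.
Context {R : realType} {X : normedModType R}.
Implicit Types (u : nat -> X) (s : nat -> nat).

Lemma weak_cvg_subseq u s a : {homo s : m n / (m < n)%N} ->
  weak_cvg u a -> weak_cvg (u \o s) a.
Proof. by move=> /subsequence_cvg sh ua; apply: cvg_comp sh ua. Qed.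

Lemma weak_cvg_bounded u a :
  weak_cvg u a -> exists M : R, forall n, `|u n| <= M.
Proof.
move=> /weak_cvgP ua; apply: weakly_bounded_bounded => phi.
have /cvg_seq_bounded[M [_ /(_ (M + 1))]] :
    cvgn (fun n => sval phi (u n) : R^o).
  by apply/cvg_ex; exists (sval phi a).
by rewrite ltrDl => /(_ ltr01) MM; exists (M + 1) => n; exact: MM.
Qed.

(** The functional norming [a - b] passes to the weak limit and is bounded by
    the norm at every [u n - v n]. *)
Lemma norm_weak_lsc u v a b w : weak_cvg u a -> weak_cvg v b ->
  (forall n, `|u n - v n| <= w n) -> forall c : R, w n @[n --> \oo] --> c ->
  `|a - b| <= c.
Proof.
move=> /weak_cvgP ua /weak_cvgP vb uvw c wc.
have [phi [<- phile]] := norming_dual (a - b).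
rewrite dualB; apply: ler_cvg_to (cvgB (ua phi) (vb phi)) wc _.
apply: nearW => n.
have := le_trans (ler_norm _) (le_trans (phile (u n - v n)) (uvw n)).
by rewrite dualB.
Qed.

Lemma weak_cvg_shift u v a : weak_cvg u a ->
  `|u n - v n| @[n --> \oo] --> (0 : R) -> weak_cvg v a.
Proof.
move=> /weak_cvgP ua uv; apply/weak_cvgP => phi.
have duv : u n - v n @[n --> \oo] --> (0 : X) by exact: norm_cvg0.
have /weak_cvgP/(_ phi) := strong_weak_cvg duv.
rewrite linear0 => d0.
have -> : (fun n => sval phi (v n)) =
    (fun n => sval phi (u n) - sval phi (u n - v n)).
  by apply/funext => n; rewrite dualB subKr.
rewrite -[X in _ --> X]subr0; exact: cvgB.
Qed.

Lemma weakly_closed_map_cvg (C : set X) (Phi : X -> set X) u v a b :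
  weakly_closed_map C Phi -> (forall n, C (u n)) -> C a ->
  (forall n, Phi (u n) (v n)) -> weak_cvg u a -> weak_cvg v b -> Phi a b.
Proof.
move=> /closed_subspaceP[V cV VE] Cu Ca Puv ua vb.
suff Vab : V (a, b).
  have : (V `&` (C `*` setT)) (a, b) by split.
  by rewrite VE => -[[]].
apply: (@closed_cvg _ (weak X * weak X)%type \oo _ (fun n => (u n, v n)) V cV).
  apply: nearW => n.
  have : ([set p | C p.1 /\ Phi p.1 p.2] `&` (C `*` setT)) (u n, v n).
    by split; split=> //=; exact: Cu.
  by rewrite -VE => -[].
exact: (cvg_pair ua vb).
Qed.

End WeakSequences.

(** * Equilibrium problems along the algorithm *)

Section Equilibrium.
Context {R : realType} {X : normedModType R}.
Variables (C : set X) (Phi : X -> set X) (f : X -> X -> R).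

(** When the algorithm stops at step [k], the solution and the projection found
    at that step serve for all later indices, since the sequence is constant
    from [k] on. *)
Lemma algorithm_step (x : nat -> X) : generated_by_algorithm C f Phi x ->
  forall i, exists z, Sol f (Phi (x i)) z /\ metric_proj C z (x i.+1).
Proof.
move=> [_ step stop] i.
have [go|] := pselect (forall k, (k < i)%N -> x k.+1 <> x k).
  by have [z] := step i go; exists z.
move=> /existsNP[k0 /not_implyP[k0i /contrapT xk0]].
have ex : exists k, `[< x k.+1 = x k >] by exists k0; apply/asboolP.
(* only the first stopping step is known to have been carried out *)
case: (ex_minnP ex) => k /asboolP xk kmin.
have ki : (k <= i)%N.
  by apply: leq_trans (ltnW k0i); apply: kmin; apply/asboolP.
have [|z zS zP] := step k.
  by move=> j jk /asboolP/kmin; rewrite leqNgt jk.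
exists z; rewrite (stop _ xk _ ki) (stop _ xk i.+1 (leqW ki)); split => //.
by rewrite -xk.
Qed.

(** Lower semicontinuity approximates [y] strongly by feasible points [v k];
    replacing [v k] by [y] in [0 <= f (z (s k)) (v k)] costs at most
    [M * `|v k - y|]. *)
Lemma equilibrium_liminf (h : X -> R) (M : R) (x z : nat -> X) (a y : X) :
  (forall u v w, image_of Phi C u -> image_of Phi C v -> image_of Phi C w ->
     `|f u v - f u w| <= h u * `|v - w|) ->
  (forall n, h (z n) <= M) ->
  (forall n, C (x n)) -> (forall n, Sol f (Phi (x n)) (z n)) ->
  C a -> seq_weakly_lsc_at C Phi a -> weak_cvg x a -> Phi a y ->
  exists2 s : nat -> nat, {homo s : m n / (m < n)%N} &
    (0 <= limn_einf (fun k => (f (z (s k)) y)%:E))%E.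
Proof.
move=> f_lip hM Cx zS Ca lsc xa Pay.
have [s [v [sh Pv vy]]] := lsc x Cx xa y Pay; exists s => //.
have g0 : - (M * `|v k - y|) @[k --> \oo] --> (0 : R).
  rewrite -oppr0 -(mulr0 M); apply: cvgN; apply: cvgMl_tmp.
  rewrite -(normr0 X) -(subrr y); apply: cvg_norm.
  by apply: cvgB => //; exact: cvg_cst.
apply: (limn_einf_ge0 g0) => k.
have im n u : Phi (x n) u -> image_of Phi C u by exists (x n).
have zI : image_of Phi C (z (s k)) by apply: (im (s k)); have [] := zS (s k).
have yI : image_of Phi C y by exists a.
have := f_lip _ _ _ zI (im _ _ (Pv k)) yI.
have := (zS (s k)).2 _ (Pv k).
have : h (z (s k)) * `|v k - y| <= M * `|v k - y| by rewrite ler_wpM2r.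
by rewrite ler_norml => ? ? /andP[_]; lra.
Qed.

End Equilibrium.
Theorem theorem3p1 (R : realType) (X : normedModType R)
  (C : set X) (Phi : X -> set X) (f : X -> X -> R) (h : X -> R)
  (C_neq0 : C !=set0)
  (C_convex : convex_set C)
  (C_weakly_compact : weakly_compact C)
  (Phi_neq0 : forall x, C x -> Phi x !=set0)
  (Phi_convex : forall x, C x -> convex_set (Phi x))
  (image_compact : relatively_weakly_compact (image_of Phi C))
  (Phi_lsc : forall x, C x -> seq_weakly_lsc_at C Phi x)
  (Phi_closed : weakly_closed_map C Phi)
  (f_diag : forall x, image_of Phi C x -> f x x = 0)
  (f_convex : forall x, image_of Phi C x ->
     convex_set [set y | image_of Phi C y /\ f x y < 0])
  (f_usc : forall y, image_of Phi C y -> seq_usc (f^~ y))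
  (f_Splus : type_Splus f (image_of Phi C))
  (h_ge0 : forall x, 0 <= h x)
  (h_bounded : forall B : set X, bounded_set B -> bounded_set (h @` B))
  (f_lip : forall x y z,
     image_of Phi C x -> image_of Phi C y -> image_of Phi C z ->
     `|f x y - f x z| <= h x * `|y - z|)
  (x_ : nat -> X)
  (x_alg : generated_by_algorithm C f Phi x_)
  (x_reg : asymptotically_regular x_) :
  exists2 x : X, weak_limit_point x_ x & projected_solution C f Phi x.
Proof.
have [x0C _ _] := x_alg.
have [z zP] := choice (algorithm_step x_alg).
have zS n := (zP n).1; have zproj n := (zP n).2.
have xC n : C (x_ n) by case: n => // n; have [] := zproj n.
have imI n y : Phi (x_ n) y -> image_of Phi C y by exists (x_ n).
have zI n : image_of Phi C (z n) by apply: (imI n); have [] := zS n.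
have [s1 [s1h [xb xbC xs1]]] := weakly_compact_subseq C_weakly_compact xC.
have [|s2 [s2h [zb _ zs2]]] :=
  weakly_compact_subseq (u := z \o s1) image_compact.
  by move=> n; apply: subset_closure; exact: zI.
pose s := s1 \o s2.
have sh : {homo s : m n / (m < n)%N} by move=> m n /s2h /s1h.
have xs : weak_cvg (x_ \o s) xb by exact: (weak_cvg_subseq s2h xs1).
have zs : weak_cvg (z \o s) zb by [].
have zbPhi : Phi xb zb.
  apply: (weakly_closed_map_cvg Phi_closed _ _ _ xs zs) => //= n.
  by have [] := zS (s n).
have zbI : image_of Phi C zb by exists xb.
have [M hM] : exists M : R, forall n, h (z (s n)) <= M.
  have [N zN] := weak_cvg_bounded zs.
  have [|M [_ /(_ (M + 1))]] := h_bounded [set y | `|y| <= N].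
    exists N; split=> [|r Nr y /= yN]; first exact: num_real.
    exact: le_trans yN (ltW Nr).
  rewrite ltrDl => /(_ ltr01) hM; exists (M + 1) => n.
  apply: (le_trans (ler_norm _)); apply: hM.
  by exists (z (s n)) => //; exact: zN.
(* testing with [y := zb] is what the type [S_+] property needs *)
have [s3 s3h f_inf] := equilibrium_liminf f_lip hM (fun n => xC (s n))
  (fun n => zS (s n)) xbC (Phi_lsc _ xbC) xs zbPhi.
have zcvg : z (s (s3 n)) @[n --> \oo] --> zb.
  apply: f_Splus f_inf => //; exact: (weak_cvg_subseq s3h zs).
have xs3 := weak_cvg_subseq s3h xs.
exists xb; first by exists (s \o s3) => // m n /s3h /sh.
split=> //; exists zb.
  split=> // y Phiy; have yI : image_of Phi C y by exists xb.
  have [s4 s4h f_inf4] := equilibrium_liminf f_lip (fun n => hM (s3 n))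
    (fun n => xC (s (s3 n))) (fun n => zS (s (s3 n)))
    xbC (Phi_lsc _ xbC) xs3 Phiy.
  rewrite -lee_fin; apply: (le_trans f_inf4).
  apply: (le_trans (limn_einf_sup _)).
  apply: (f_usc _ yI (fun k => z (s (s3 (s4 k)))) zb).
  exact: (cvg_comp _ _ (subsequence_cvg s4h) zcvg).
split=> // w wC.
apply: (norm_weak_lsc (v := fun n => x_ (s (s3 n)).+1) (strong_weak_cvg zcvg) _
  (fun n => (zproj (s (s3 n))).2 w wC)).
  apply: (weak_cvg_shift xs3).
  have s3s : {homo s \o s3 : m n / (m < n)%N} by move=> m n /s3h /sh.
  exact: (cvg_comp _ _ (subsequence_cvg s3s) x_reg).
by apply: cvg_norm; apply: cvgB => //; exact: cvg_cst.
Qed.
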